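(* Let $n$ be a positive integer and let $\lambda,\mu,\nu$ be partitions such that $\ell(\lambda)\le n$ and $\mu,\nu\subseteq\lambda$ with $|\lambda|=|\mu|+|\nu|$. For each LR hive $H\in\mathcal{H}^{(n)}(\lambda,\mu,\nu)$, the path removal procedure reduces $H=H^{(n)}$ to the empty hive $H^{(0)}$, and the resulting partner array $K=\sigma^{(n)}H$ is an LR hive with $K\in\mathcal{H}^{(n)}(\lambda,\nu,\mu)$.
   Context: Partitions. A partition has weakly decreasing nonnegative integer parts; $\ell(\lambda)$ is the number of positive parts, $|\lambda|$ the sum of the parts, and $\mu\subseteq\lambda$ means $\mu_i\le\lambda_i$ for all $i$. Partitions of length $\le n$ are padded with zeros to $n$ parts. Hives. An integer $n$-hive is a family of integers $a_{ij}$ ($0\le i\le j\le n$), $a_{00}=0$ (vertex labels of a triangular array of side $n$), with edge labels $\alpha_{ij}=a_{ij}-a_{i,j-1}$ ($0\le i<j\le n$), $\beta_{ij}=a_{ij}-a_{i-1,j}$, $\gamma_{ij}=a_{ij}-a_{i-1,j-1}$ ($1\le i\le j\le n$), such that for all $1\le i<j\le n$ the gradients $R_{ij}=\alpha_{i-1,j-1}-\alpha_{ij}$, $U_{ij}=\alpha_{ij}-\alpha_{i-1,j}=\beta_{ij}-\beta_{i,j-1}$, $L_{ij}=\beta_{i,j-1}-\beta_{i+1,j}$ are $\ge0$. Edge labels satisfy the triangle conditions $\gamma_{ij}=\alpha_{i-1,j}+\beta_{ij}$ and $\gamma_{ij}=\beta_{i,j-1}+\alpha_{ij}$ ($i<j$)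 and determine the hive. $U_{ij}$ is the $(i,j)$ upright rhombus gradient; the $j$-th diagonal comprises the upright rhombi $(i,j)$, $i=1,\dots,j-1$, and the triangle with bottom edge $\gamma_{jj}$. An LR hive is an integer hive with all edge labels $\ge0$. $\mathcal{H}^{(n)}(\lambda,\mu,\nu)$ is the set of LR $n$-hives with lower boundary $\gamma_{kk}=\lambda_k$, left boundary $\alpha_{0k}=\mu_k$, right boundary $\beta_{kn}=\nu_k$ ($1\le k\le n$). Level $k$ of the left boundary is the edge $\alpha_{0k}$. The empty hive is the $0$-hive (a single vertex). Path removals on $H\in\mathcal{H}^{(r)}(\lambda,\mu,\nu)$ (changing edge labels): (i) $\chi_r$ (if $\nu_r>0$): decrease $\gamma_{rr}$ and $\beta_{rr}$ by 1. (ii) $\phi_r$ (if $U_{ir}>0$ for some $i<r$, equivalently $\lambda_r-\mu_r-\nu_r>0$): put $i_{r+1}=r$ and for $d=r,r-1,\dots$ let $i_d=\max\{i<i_{d+1}:U_{id}>0\}$ as long as this set is nonempty; let $k$ be the first $d$ for which it is empty, and put $i_k=0$ (so $1\le k<r$). Decrease by 1 the labels $\gamma_{rr}$, $\alpha_{id}$ for $i_d\le i<i_{d+1}$, and $\gamma_{id}$ for $i_d<i<i_{d+1}$ ($k\le d\le r$), and increase by 1 the labels $\beta_{i_d,d-1}$ ($k<d\le r$). The path is said to terminate at level $k$. (iii) $\omega_r$ (if $\mu_r>0$): decrease by 1 all $\alpha_{ir}$ ($0\le i<r$) and $\gamma_{ir}$ ($1\le i\le r$). Full $r$-hive path removal: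 $\theta_r=\omega_r^{\mu_r}\phi_r^{\lambda_r-\mu_r-\nu_r}\chi_r^{\nu_r}$ (rightmost acts first) if $\ell(\lambda)=r$, and the identity if $\ell(\lambda)<r$. It makes the $r$-th diagonal empty (boundary labels $\gamma_{rr},\alpha_{0r},\beta_{rr}$ and gradients $U_{ir}$ all zero). $\kappa_r$ deletes an empty $r$-th diagonal, turning the $r$-hive into an $(r-1)$-hive. Partner array. Set $H^{(n)}=H$ and $H^{(r-1)}=\kappa_r\theta_rH^{(r)}$ for $r=n,\dots,1$. For $1\le k<r\le n$ let $V_{kr}$ be the number of the $\phi_r$-paths removed in applying $\theta_r$ to $H^{(r)}$ that terminate at level $k$. Then $K=\sigma^{(n)}H$ is the triangular array satisfying the triangle conditions with left boundary labels $\nu_1,\dots,\nu_n$, right boundary labels $\mu_1,\dots,\mu_n$, and upright rhombus gradients $V_{kr}$; that is, $\alpha_{ij}=\nu_j+\sum_{k\le i}V_{kj}$, $\beta_{ij}=\mu_i-\sum_{m>j}V_{im}$, $\gamma_{ij}=\alpha_{i-1,j}+\beta_{ij}$. *)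

(* Defs.v *)
From HB Require Import structures.
From mathcomp Require Import all_boot all_order all_algebra.

Set Implicit Arguments.
Unset Strict Implicit.
Unset Printing Implicit Defensive.

Import Order.TTheory GRing.Theory Num.Theory.

Local Open Scope ring_scope.

(* A partition is a weakly decreasing [seq nat]; zero parts may be listed, and
   [part la k] is the k-th part (k >= 1), with zero padding. *)
Definition is_partition (la : seq nat) : bool := sorted geq la.

Definition part (la : seq nat) (k : nat) : nat := nth 0%N la k.-1.

Definition plength (la : seq nat) : nat := count (fun x => 0 < x)%N la.

Definition part_sub (mu la : seq nat) : Prop :=
  forall k, (1 <= k)%N -> (part mu k <= part la k)%N.

(* A triangular array of side [side], given by its edge labels. Meaningful
   indices: al i j for 0 <= i < j <= side, be i j and ga i j for
   1 <= i <= j <= side. Values at other indices are junk that no definition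
   below depends on. *)
Record edge_array := EdgeArray {
  side : nat;
  al : nat -> nat -> int;
  be : nat -> nat -> int;
  ga : nat -> nat -> int
}.

Definition gradR (H : edge_array) (i j : nat) : int :=
  al H i.-1 j.-1 - al H i j.

Definition gradU (H : edge_array) (i j : nat) : int :=
  al H i j - al H i.-1 j.

Definition gradL (H : edge_array) (i j : nat) : int :=
  be H i j.-1 - be H i.+1 j.

(* [H] is the edge labelling of the family of vertex labels [a i j],
   0 <= i <= j <= side H. The triangle conditions follow from this, and so does
   the equality of the two expressions for the upright rhombus gradient. *)
Definition edge_labels_of (a : nat -> nat -> int) (H : edge_array) : Prop :=
  (forall i j, (i < j <= side H)%N -> al H i j = a i j - a i j.-1) /\
  (forall i j, (1 <= i <= j)%N -> (j <= side H)%N ->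
     be H i j = a i j - a i.-1 j /\ ga H i j = a i j - a i.-1 j.-1).

Definition int_hive (H : edge_array) : Prop :=
  exists a : nat -> nat -> int,
    [/\ a 0%N 0%N = 0,
        edge_labels_of a H
      & forall i j, (1 <= i < j)%N -> (j <= side H)%N ->
          [/\ 0 <= gradR H i j, 0 <= gradU H i j & 0 <= gradL H i j]].

Definition LR_hive (H : edge_array) : Prop :=
  [/\ int_hive H,
      forall i j, (i < j <= side H)%N -> 0 <= al H i j
    & forall i j, (1 <= i <= j)%N -> (j <= side H)%N ->
        0 <= be H i j /\ 0 <= ga H i j].

Definition LR_hives (n : nat) (la mu nu : seq nat) (H : edge_array) : Prop :=
  [/\ side H = n,
      LR_hive H
    & forall k, (1 <= k <= n)%N ->
        [/\ ga H k k = (part la k)%:Z,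
            al H 0 k = (part mu k)%:Z
          & be H k n = (part nu k)%:Z]].

Definition empty_hive (H : edge_array) : Prop := side H = 0%N /\ int_hive H.

(* lambda_r, mu_r, nu_r for an r-hive, r = side H *)
Definition lam_last (H : edge_array) : int := ga H (side H) (side H).
Definition mu_last (H : edge_array) : int := al H 0 (side H).
Definition nu_last (H : edge_array) : int := be H (side H) (side H).

(* The number of positive labels on the lower boundary. *)
Definition lower_length (H : edge_array) : nat :=
  count (fun k => 0 < ga H k k) (iota 1 (side H)).

Definition chi_ok (H : edge_array) : Prop := 0 < nu_last H.

Definition chi (H : edge_array) : edge_array :=
  let r := side H in
  EdgeArray r (al H)
    (fun i j => if (i == r) && (j == r) then be H i j - 1 else be H i j)
    (fun i j => if (i == r) && (j == r) then ga H i j - 1 else ga H i j).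

Definition phi_ok (H : edge_array) : Prop :=
  exists i, (1 <= i < side H)%N /\ 0 < gradU H i (side H).

(* max {1 <= i < m : U_id > 0}, or 0 if this set is empty *)
Definition max_row (H : edge_array) (d m : nat) : nat :=
  (\max_(1 <= i < m | (0 < gradU H i d)%R) i)%N.

Fixpoint phi_row_down (H : edge_array) (t : nat) : nat :=
  if t is t'.+1 then max_row H (side H - t') (phi_row_down H t') else side H.

(* The row i_d of the phi_r-path in diagonal d <= r.+1, starting from
   i_{r+1} = r. Below the terminating level it stays 0. *)
Definition phi_row (H : edge_array) (d : nat) : nat :=
  phi_row_down H ((side H).+1 - d).

(* The terminating level: the first d, going down from r, where i_d = 0. *)
Definition phi_level (H : edge_array) : nat :=
  (\max_(1 <= d < (side H).+1 | phi_row H d == 0) d)%N.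

Definition phi (H : edge_array) : edge_array :=
  let r := side H in
  let k := phi_level H in
  EdgeArray r
    (fun i d => if (k <= d <= r)%N && (phi_row H d <= i < phi_row H d.+1)%N
                then al H i d - 1 else al H i d)
    (fun i j => if (k < j.+1 <= r)%N && (i == phi_row H j.+1)
                then be H i j + 1 else be H i j)
    (fun i d => if ((i == r) && (d == r)) ||
                   ((k <= d <= r)%N && (phi_row H d < i < phi_row H d.+1)%N)
                then ga H i d - 1 else ga H i d).

Definition omega_ok (H : edge_array) : Prop := 0 < mu_last H.

Definition omega (H : edge_array) : edge_array :=
  let r := side H in
  EdgeArray r
    (fun i j => if (i < r)%N && (j == r) then al H i j - 1 else al H i j)
    (be H)
    (fun i j => if (1 <= i <= r)%N && (j == r) then ga H i j - 1 else ga H i j).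

(* The three exponents of theta_r are read off the r-hive before any removal. *)
Definition phi_count (H : edge_array) : int :=
  lam_last H - mu_last H - nu_last H.

Definition after_chi (H : edge_array) : edge_array :=
  iter `|nu_last H|%N chi H.

Definition after_phi (H : edge_array) : edge_array :=
  iter `|phi_count H|%N phi (after_chi H).

Definition after_omega (H : edge_array) : edge_array :=
  iter `|mu_last H|%N omega (after_phi H).

Definition theta (H : edge_array) : edge_array :=
  if lower_length H == side H then after_omega H else H.

(* The path removal [f] can legitimately be applied m times in succession,
   starting from [H]: m >= 0, and each removal acts on an LR hive on which it is
   defined. *)
Definition removable (ok : edge_array -> Prop) (f : edge_array -> edge_array)
    (m : int) (H : edge_array) : Prop :=
  0 <= m /\
  forall t : nat, (t < `|m|)%N -> LR_hive (iter t f H) /\ ok (iter t f H).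

Definition theta_defined (H : edge_array) : Prop :=
  lower_length H = side H ->
  [/\ removable chi_ok chi (nu_last H) H,
      removable phi_ok phi (phi_count H) (after_chi H)
    & removable omega_ok omega (mu_last H) (after_phi H)].

Definition empty_diagonal (H : edge_array) : Prop :=
  let r := side H in
  [/\ ga H r r = 0, al H 0 r = 0, be H r r = 0
    & forall i, (1 <= i < r)%N -> gradU H i r = 0].

(* The labels of the last diagonal are those with second index [side H], so they
   are deleted by decreasing the side. *)
Definition kappa (H : edge_array) : edge_array :=
  EdgeArray (side H).-1 (al H) (be H) (ga H).

(* H^(r), for r <= side H *)
Definition reduced (H : edge_array) (r : nat) : edge_array :=
  iter (side H - r) (fun G => kappa (theta G)) H.

(* The number of phi-paths removed by theta that terminate at level k. *)
Definition phi_terminations (H : edge_array) (k : nat) : nat :=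
  if lower_length H == side H then
    count (fun t => phi_level (iter t phi (after_chi H)) == k)
          (iota 0 `|phi_count H|%N)
  else 0%N.

Definition partnerV (H : edge_array) (k r : nat) : nat :=
  phi_terminations (reduced H r) k.

Definition partner (H : edge_array) : edge_array :=
  let n := side H in
  let alK i j := be H j n + (\sum_(1 <= k < i.+1) partnerV H k j)%N%:Z in
  let beK i j := al H 0 i - (\sum_(j.+1 <= m < n.+1) partnerV H i m)%N%:Z in
  EdgeArray n alK beK (fun i j => alK i.-1 j + beK i j).

(* Main.v *)
Require Import Defs.
From mathcomp Require Import all_boot all_order all_algebra.
From mathcomp Require Import zify.

(** An LR hive of side n is a Littlewood-Richardson tableau in disguise: row d
    consists of mu_d empty boxes followed, for each i < d, by [gradU H i d]
    letters i, and by [be H d d] letters d. The inequalities R >= 0 say that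
    columns are strict, and L >= 0 is the lattice word condition. In this
    picture a phi-path deletes the last letter of the bottom row and reverse
    inserts it: the letter i_{d+1} arriving in row d displaces the largest
    letter i_d < i_{d+1}, and the path terminates at the level k of the first
    row having no such letter, where an empty box of mu is filled.

    One path removal maps LR hives to LR hives ([phi_LR]): U vanishes in the
    gaps between consecutive rows of a path, and that forces the rhombus gradients
    which are about to drop to be positive.
    Counting labels on the bottom diagonal then shows that each theta runs to
    the end and leaves an empty diagonal, with lambda and nu intact
    ([theta_definedP], [theta_empty_diagonal], [reduced_spec]).

    The hive inequalities for the partner come from three facts on the paths.
    U >= 0 holds since the V are cardinalities.
    L >= 0: successive paths of one theta move weakly upwards
    ([phi_row_phi]), hence terminate at weakly increasing levels. At the moment
    when all paths of level <= i are gone, the left boundary is still a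
    partition, its part i has reached its final value, and its part i+1 has its
    initial value ([terminations_le_drop]).
    R >= 0: count the chi-removals as paths of level 0. Then the m-th path of
    the theta on side r terminates at a level less than k whenever the m-th
    path of the preceding theta, on side r+1, terminates at level k
    ([paths_interlace]): the letters which the earlier paths put into row d are
    never displaced later by those same paths, so they are still there when the
    later paths come to displace a letter in that row
    ([terminations_interlace]).

    The lower boundary of the partner is lambda since the theta on side r removes
    lambda_r - nu_r - m paths, where m is what is left then of mu_r. *)

Set Implicit Arguments.
Unset Strict Implicit.
Unset Printing Implicit Defensive.

Import Order.TTheory GRing.Theory Num.Theory.

Local Open Scope ring_scope.

(** * Hives in terms of edge labels *)

Definition triangles (H : edge_array) : Prop :=
  forall i j, (0 < i <= j)%N -> (j <= side H)%N ->
    ga H i j = al H i.-1 j + be H i j /\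
    ((i < j)%N -> ga H i j = be H i j.-1 + al H i j).

Definition rhombi (H : edge_array) : Prop :=
  forall i j, (0 < i < j)%N -> (j <= side H)%N ->
    [/\ 0 <= gradR H i j, 0 <= gradU H i j & 0 <= gradL H i j].

(** The vertex labels are recovered by summing along the left boundary and
    then down the diagonals; the triangle conditions make the result independent
    of the route, so they may replace the existential over vertex labels. *)
Lemma int_hiveP (H : edge_array) : int_hive H <-> triangles H /\ rhombi H.
Proof.
split=> [[a [_ [Hal Hbg] Hgr]]|[Htri Hrh]].
  split=> [i j hi hj|]; last exact: Hgr.
  have [Eb Eg] := Hbg i j hi hj.
  split; first by rewrite Eg Eb Hal; lia.
  by move=> lt_ij; rewrite Eg Hal ?(Hbg i j.-1 _ _).1; lia.
pose a i j := \sum_(1 <= m < j.+1) al H 0 m + \sum_(1 <= l < i.+1) be H l j.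
have aS i j : a i.+1 j = a i j + be H i.+1 j.
  by rewrite /a [X in _ + X]big_nat_recr //= addrA.
have Eal i j : (i < j <= side H)%N -> al H i j = a i j - a i j.-1.
  case: j => // j; elim: i => [|i IHi] hj /=.
    rewrite /a ![\sum_(1 <= _ < 1) _]big_geq // big_nat_recr //=.
    by rewrite !addr0 addrAC subrr add0r.
  have [] := Htri i.+1 j.+1; [lia..|] => /= E1 E2.
  by have := E2 ltac:(lia); have := IHi ltac:(lia); rewrite !aS /=; lia.
exists a; split=> //; first by rewrite /a !big_geq.
split=> // -[|i] j // hi hj.
have [E1 _] := Htri i.+1 j hi hj.
rewrite /= aS; split; first lia.
by move: E1 => /=; rewrite (Eal i j) //; lia.
Qed.

Lemma al_row_le (H : edge_array) (i i' j : nat) :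
  rhombi H -> (i <= i' < j)%N -> (j <= side H)%N -> al H i j <= al H i' j.
Proof.
move=> Hrh; elim: i' => [|i' IH] hi hj; first by have -> : i = 0%N by lia.
have [->//|ne] := eqVneq i i'.+1.
have [_ hU _] := Hrh i'.+1 j ltac:(lia) hj.
by move: hU (IH ltac:(lia) hj); rewrite /gradU /=; lia.
Qed.

Lemma be_row_le (H : edge_array) (i j j' : nat) :
  triangles H -> rhombi H -> (0 < i <= j)%N -> (j <= j' <= side H)%N ->
  be H i j <= be H i j'.
Proof.
move=> Htri Hrh hi; elim: j' => [|j' IH] hj; first lia.
have [->//|ne] := eqVneq j j'.+1.
have [_ hU _] := Hrh i j'.+1 ltac:(lia) ltac:(lia).
have [E1 E2] := Htri i j'.+1 ltac:(lia) ltac:(lia).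
by move: hU E1 (E2 ltac:(lia)) (IH ltac:(lia)); rewrite /gradU /=; lia.
Qed.

Lemma be_diag_ge (H : edge_array) (i j : nat) :
  rhombi H -> (0 < i <= j)%N -> (j <= side H)%N -> be H j j <= be H i i.
Proof.
move=> Hrh; elim: j => [|j IH] hi hj; first lia.
have [->//|ne] := eqVneq i j.+1.
have [_ _] := Hrh j j.+1 ltac:(lia) ltac:(lia).
by move: (IH ltac:(lia) ltac:(lia)); rewrite /gradL /=; lia.
Qed.

Lemma al0_ge (H : edge_array) (i j : nat) :
  rhombi H -> (0 < i <= j)%N -> (j <= side H)%N -> al H 0 j <= al H 0 i.
Proof.
move=> Hrh; elim: j => [|j IH] hi hj; first lia.
have [->//|ne] := eqVneq i j.+1.
have [hR hU _] := Hrh 1%N j.+1 ltac:(lia) ltac:(lia).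
by move: hR hU (IH ltac:(lia) ltac:(lia)); rewrite /gradR /gradU /=; lia.
Qed.

(** U >= 0 bounds the labels alpha below by those of the left boundary, and
    the labels beta by those of the lower boundary. Along these boundaries the
    labels weakly decrease, by R, U >= 0 and by L >= 0. So only the two labels in
    the last diagonal can fail to be nonnegative. *)
Lemma LR_hiveP (H : edge_array) :
  LR_hive H <->
  [/\ triangles H, rhombi H
    & (0 < side H)%N -> 0 <= mu_last H /\ 0 <= nu_last H].
Proof.
split=> [[/int_hiveP[Htri Hrh] Hal Hbg]|[Htri Hrh Hcorner]].
  split=> // n0; split; first by apply: Hal; lia.
  by have [] := Hbg (side H) (side H); rewrite ?n0 /= ?leqnn.
have al_ge0 i j : (i < j <= side H)%N -> 0 <= al H i j.
  move=> hij; have [h _] := Hcorner ltac:(lia).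
  apply: le_trans h _; apply: le_trans (al_row_le Hrh _ _); last by lia.
    by apply: (al0_ge (j := side H)) => //; lia.
  by lia.
split=> //; first by apply/int_hiveP.
move=> i j hi hj; have be0 : 0 <= be H i j.
  have [_ h] := Hcorner ltac:(lia).
  apply: le_trans h _; apply: le_trans (be_row_le Htri Hrh (j := i) _ _).
  - by apply: (be_diag_ge Hrh (j := side H)); lia.
  - by lia.
  - by lia.
split=> //; have [-> _] := Htri i j hi hj.
by rewrite addr_ge0 // al_ge0 //; lia.
Qed.

(** * A single path *)

Lemma max_row_cases (H : edge_array) (d m : nat) :
  max_row H d m = 0%N \/
  (0 < max_row H d m < m)%N /\ 0 < gradU H (max_row H d m) d.
Proof.
rewrite /max_row big_nat_cond.
apply: (big_ind (fun x => x = 0%N \/ (0 < x < m)%N /\ 0 < gradU H x d)).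
- by left.
- by move=> x y hx hy; rewrite /maxn; case: ifP.
- by move=> i /andP[hi hU]; right.
Qed.

Lemma max_row_gap (H : edge_array) (d m i : nat) :
  (max_row H d m < i < m)%N -> gradU H i d <= 0.
Proof.
case/andP=> lo hi; rewrite leNgt; apply/negP => hU.
suff : (i <= max_row H d m)%N by lia.
by rewrite /max_row; apply: leq_bigmax_seq => //; rewrite mem_index_iota; lia.
Qed.

Lemma phi_row_top (H : edge_array) (d : nat) :
  (side H < d)%N -> phi_row H d = side H.
Proof. by move=> h; rewrite /phi_row (_ : (_ - d)%N = 0%N) //; lia. Qed.

Lemma phi_rowE (H : edge_array) (d : nat) :
  (d <= side H)%N -> phi_row H d = max_row H d (phi_row H d.+1).
Proof. by move=> h; rewrite /phi_row subSn //= subSS subKn. Qed.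

Lemma phi_row_cases (H : edge_array) (d : nat) : (d <= side H)%N ->
  phi_row H d = 0%N \/
  (0 < phi_row H d < phi_row H d.+1)%N /\ 0 < gradU H (phi_row H d) d.
Proof. by move=> h; rewrite phi_rowE //; apply: max_row_cases. Qed.

Lemma phi_row_gap (H : edge_array) (d i : nat) : (d <= side H)%N ->
  (phi_row H d < i < phi_row H d.+1)%N -> gradU H i d <= 0.
Proof. by move=> h; rewrite phi_rowE //; apply: max_row_gap. Qed.

(** The rows of a path are defined from the bottom diagonal upwards, so
    statements about them are proved from r+1 downwards. *)
Lemma descending_ind (P : nat -> Prop) (r : nat) :
  P r.+1 -> (forall d, (d <= r)%N -> P d.+1 -> P d) ->
  forall d, (d <= r.+1)%N -> P d.
Proof.
move=> Ptop Pstep d hd; rewrite -(subKn hd).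
elim: (r.+1 - d)%N => [|m IH]; first by rewrite subn0.
have [hm|hm] := leqP m r; last first.
  by move: IH; have -> : (r.+1 - m)%N = (r.+1 - m.+1)%N by lia.
by apply: Pstep; [lia|rewrite -subSn].
Qed.

(** The rows strictly decrease from i_{r+1} = r, which is why every path
    terminates, at level 1 at the latest. *)
Lemma phi_row_bound (H : edge_array) (d : nat) :
  (0 < d <= (side H).+1)%N -> (phi_row H d < d)%N.
Proof.
case/andP=> d0 hd; move: d0.
pose P d := (0 < d -> phi_row H d < d)%N.
apply: (descending_ind (P := P) (r := side H)) => //.
  by rewrite /P phi_row_top.
by move=> e he IH e0; have := IH isT; case: (phi_row_cases he); lia.
Qed.

Lemma phi_row_pos_up (H : edge_array) (d e : nat) :
  (0 < phi_row H d)%N -> (d <= e <= side H)%N -> (0 < phi_row H e)%N.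
Proof.
move=> h; elim: e => [|e IH] he; first by move: h; have -> : d = 0%N by lia.
have [<-//|ne] := eqVneq d e.+1.
have [] := @phi_row_cases H e ltac:(lia); last lia.
by have := IH ltac:(lia); lia.
Qed.

(** Positivity of i_d is equivalent to the path not having terminated yet,
    so the level can be eliminated in favour of the rows. *)
Lemma phi_level_lt (H : edge_array) (d : nat) :
  (0 < d <= side H)%N -> (phi_level H < d)%N = (0 < phi_row H d)%N.
Proof.
move=> hd; apply/idP/idP => [|h].
  rewrite !ltnNge; apply: contra => h0.
  by rewrite /phi_level; apply: leq_bigmax_seq; rewrite ?mem_index_iota; lia.
rewrite /phi_level big_nat_cond.
apply: (big_ind (fun x => x < d)%N) => [|x y hx hy|e]; try lia.
case/andP=> he /eqP e0; rewrite ltnNge; apply/negP => hde.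
by have := @phi_row_pos_up H d e h ltac:(lia); lia.
Qed.

Lemma phi_level_eq (H : edge_array) (k : nat) : (0 < k < side H)%N ->
  (phi_level H == k) = (phi_row H k == 0%N) && (0 < phi_row H k.+1)%N.
Proof.
move=> hk; have := @phi_level_lt H k ltac:(lia).
by have := @phi_level_lt H k.+1 ltac:(lia); lia.
Qed.

Lemma phi_level_le (H : edge_array) : (phi_level H <= side H)%N.
Proof.
rewrite /phi_level big_nat_cond.
by apply: (big_ind (fun x => x <= side H)%N); lia.
Qed.

(** Below the terminating level all rows are 0, so the interval of indices is
    empty there; this is how the level disappears from the formula. *)
Lemma phi_al (H : edge_array) (i d : nat) : (0 < d <= side H)%N ->
  al (phi H) i d = al H i d - (phi_row H d <= i < phi_row H d.+1)%N%:Z.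
Proof.
move=> hd /=; have := phi_level_le H.
have [hr|hr] := eqVneq d (side H); first by rewrite hr; case: ifP; lia.
by have := @phi_level_lt H d.+1 ltac:(lia); case: ifP; lia.
Qed.

Lemma phi_be (H : edge_array) (i j : nat) : (0 < i)%N -> (j < side H)%N ->
  be (phi H) i j = be H i j + (i == phi_row H j.+1)%:Z.
Proof.
by move=> hi hj /=; have := @phi_level_lt H j.+1 ltac:(lia); case: ifP; lia.
Qed.

Lemma phi_be_last (H : edge_array) (i : nat) :
  be (phi H) i (side H) = be H i (side H).
Proof. by rewrite /= ltnn andbF. Qed.

Lemma phi_ga (H : edge_array) (i d : nat) : (0 < d <= side H)%N ->
  ga (phi H) i d = ga H i d
    - (((i == side H) && (d == side H)) ||
       (phi_row H d < i < phi_row H d.+1)%N)%:Z.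
Proof.
move=> hd /=; have := phi_level_le H.
have [hr|hr] := eqVneq d (side H); first by rewrite hr; case: ifP; lia.
by have := @phi_level_lt H d.+1 ltac:(lia); case: ifP; lia.
Qed.

(** The bumping rule: the letter i_d leaves row d and the letter i_{d+1}
    enters it. *)
Lemma phi_gradU (H : edge_array) (i d : nat) :
  (0 < i < d)%N -> (d <= side H)%N ->
  gradU (phi H) i d =
  gradU H i d - (phi_row H d == i)%:Z + (phi_row H d.+1 == i)%:Z.
Proof.
case: i => // i hi hd; rewrite /gradU !phi_al; try lia.
by rewrite [i.+1.-1]/=; case: (phi_row_cases hd); lia.
Qed.

(** Between i_d and i_{d+1} row d had no letters, and the removal has put
    none there. A path that arrives in row d no further right than its
    predecessor therefore leaves it no further right. *)
Lemma phi_row_phi (H : edge_array) (d : nat) :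
  (0 < d)%N -> (phi_row (phi H) d <= phi_row H d)%N.
Proof.
have [hd|hd _] := leqP d (side H).+1; last by rewrite !phi_row_top /=; lia.
pose P d := (0 < d -> phi_row (phi H) d <= phi_row H d)%N.
apply: (descending_ind (P := P) (r := side H)) => //.
  by rewrite /P !phi_row_top.
move=> e he IH e0; have {}IH := IH isT; rewrite leqNgt; apply/negP => lt.
have [|[lt' hU]] := @phi_row_cases (phi H) e he; first lia.
have := @phi_row_gap H e (phi_row (phi H) e) he ltac:(lia).
have := @phi_row_bound H e.+1 ltac:(lia).
move=> hb; move: hU; rewrite phi_gradU; lia.
Qed.

Lemma phi_ok_row (H : edge_array) :
  phi_ok H -> (0 < phi_row H (side H))%N.
Proof.
move=> [i [hi hU]]; rewrite lt0n; apply/eqP => h0.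
have := @phi_row_gap H (side H) i (leqnn _).
by rewrite h0 phi_row_top // => /(_ hi); lia.
Qed.

(** Only a few gradients can drop. R at (i, j) drops if i_{j-1} < i < i_j;
    there alpha is constant along diagonal j-1 from row i-1 to row i_j - 1,
    while on diagonal j the label still grows by U at (i_j, j), so R was
    positive. L at (i, j) drops if i+1 = i_{j+1} and i is not i_j; then U
    vanishes at (i, j) and is positive at (i+1, j+1), so L was positive, by
    comparison with L at (i, j+1). *)
Lemma phi_LR (H : edge_array) : LR_hive H -> phi_ok H -> LR_hive (phi H).
Proof.
move=> /LR_hiveP[Htri Hrh Hc] /phi_ok_row hok.
set r := side H in hok.
have tri' : triangles (phi H).
  move=> [|i] j hi hj //.
  have {}hj : (j <= side H)%N := hj.
  have [E1 E2] := Htri i.+1 j hi hj.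
  have top : phi_row H r.+1 = r by apply: phi_row_top.
  have rcase := phi_row_cases hj.
  split.
    rewrite phi_ga ?phi_al; try lia.
    have [er|ner] := eqVneq j (side H).
      rewrite er phi_be_last -/r !top.
      by move: E1 rcase; rewrite er -/r top [i.+1.-1]/=; lia.
    have hb := @phi_row_bound H j.+1 ltac:(lia).
    by rewrite phi_be; try lia; move: E1; rewrite [i.+1.-1]/=; lia.
  move=> lt; have {}E2 := E2 lt.
  rewrite phi_ga ?phi_al ?phi_be; try lia.
  by rewrite prednK; lia.
apply/LR_hiveP; split=> //.
  move=> [|i] [|j] // hi hj; have {}hj : (j.+1 <= side H)%N := hj.
  have [hR hU hL] := Hrh _ _ hi hj.
  have rj := phi_row_cases hj.
  split.
  - rewrite /gradR !phi_al; try lia.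
    rewrite ![_.-1]/=; move: hR; rewrite /gradR ![_.-1]/= => hR.
    have rj' := @phi_row_cases H j ltac:(lia).
    have [|] := boolP ((phi_row H j < i.+1 < phi_row H j.+1)%N); last lia.
    set b := phi_row H j.+1 in rj rj' *.
    move=> hi'.
    have hb : (b < j.+1)%N by apply: phi_row_bound; lia.
    (* Strictness comes from the gradient R in the row where the path enters. *)
    have [hR2 _ _] := Hrh b j.+1 ltac:(lia) hj.
    have eqal : forall m, (i <= m < b)%N -> al H m j <= al H i j.
      elim=> [|m IH] hm; first by have -> : i = 0%N by lia.
      have [->//|ne] := eqVneq i m.+1.
      have := @phi_row_gap H j m.+1 ltac:(lia) ltac:(lia).
      by have := IH ltac:(lia); rewrite /gradU /=; lia.
    have h1 := eqal b.-1 ltac:(lia).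
    have h2 := @al_row_le H i.+1 b.-1 j.+1 Hrh ltac:(lia) hj.
    by move: hR2 rj; rewrite /gradR /gradU /=; lia.
  - rewrite phi_gradU //; have hb := @phi_row_bound H j.+1 ltac:(lia).
    by move: rj hU; have [->|] := eqVneq (phi_row H j.+1) i.+1; lia.
  - rewrite /gradL [j.+1.-1]/= (@phi_be H _ j) //.
    move: hL; rewrite /gradL [j.+1.-1]/= => hL.
    have [er|ner] := eqVneq j.+1 (side H).
      by rewrite er phi_be_last -er; lia.
    rewrite phi_be //; try lia.
    have [/eqP e2|] := boolP (i.+2 == phi_row H j.+2); last lia.
    have [|] := boolP (i.+1 == phi_row H j.+1); first lia.
    move=> ne; have := @phi_row_gap H j.+1 i.+1 hj ltac:(lia).
    have hj2 : (j.+2 <= side H)%N by lia.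
    case: (phi_row_cases hj2); first lia.
    rewrite -e2 => -[_ hU2] hU0.
    have [_ _ hL2] := Hrh i.+1 j.+2 ltac:(lia) hj2.
    have [t1 t2] := Htri i.+2 j.+2 ltac:(lia) hj2.
    have [t3 t4] := Htri i.+1 j.+1 ltac:(lia) hj.
    have {}t2 := t2 ltac:(lia); have {}t4 := t4 ltac:(lia).
    by move: hL2 hU2 hU0 hU t1 t2 t3 t4; rewrite /gradL /gradU ![_.-1]/=; lia.
move=> h0; have {}h0 : (0 < side H)%N := h0.
have [hmu hnu] := Hc h0; split.
  rewrite /mu_last phi_al; last by rewrite /=; lia.
  by rewrite [side _]/= -/r; move: hmu; rewrite /mu_last -/r; lia.
by rewrite /nu_last [side (phi H)]/= phi_be_last.
Qed.

(** * Successive paths *)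

Definition path_row (G : edge_array) (t d : nat) : nat :=
  phi_row (iter t phi G) d.

Lemma iter_phi_side (G : edge_array) (t : nat) :
  side (iter t phi G) = side G.
Proof. by elim: t => //= t. Qed.

Lemma path_row_top (G : edge_array) (t d : nat) :
  (side G < d)%N -> path_row G t d = side G.
Proof. by move=> h; rewrite /path_row phi_row_top iter_phi_side. Qed.

Lemma path_row_antitone (G : edge_array) (s t d : nat) :
  (0 < d)%N -> (s <= t)%N -> (path_row G t d <= path_row G s d)%N.
Proof.
move=> d0; elim: t => [|t IH] st; first by have -> : s = 0%N by lia.
have [->//|ne] := eqVneq s t.+1.
by apply: leq_trans (IH ltac:(lia)); apply: phi_row_phi.
Qed.

Lemma path_row_step (G : edge_array) (t d : nat) : (d <= side G)%N ->
  path_row G t d = 0%N \/ (0 < path_row G t d < path_row G t d.+1)%N.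
Proof.
move=> h; have [] := @phi_row_cases (iter t phi G) d _.
- by rewrite iter_phi_side.
- by left.
- by case; right.
Qed.

Lemma path_row_bound (G : edge_array) (t d : nat) :
  (0 < d <= (side G).+1)%N -> (path_row G t d < d)%N.
Proof. by move=> h; apply: phi_row_bound; rewrite iter_phi_side. Qed.

(** The content of a row after t paths: what was there, minus the letters
    displaced from it, plus the letters inserted into it. *)
Lemma iter_phi_gradU (G : edge_array) (t i d : nat) :
  (0 < i < d)%N -> (d <= side G)%N ->
  gradU (iter t phi G) i d =
  gradU G i d - (\sum_(0 <= s < t) (path_row G s d == i))%N%:Z
              + (\sum_(0 <= s < t) (path_row G s d.+1 == i))%N%:Z.
Proof.
move=> hi hd; elim: t => [|t IH]; first by rewrite !big_geq //= subr0 addr0.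
rewrite iterS phi_gradU ?iter_phi_side // IH !big_nat_recr //= /path_row; lia.
Qed.

Lemma iter_phi_al0 (G : edge_array) (t d : nat) : (0 < d <= side G)%N ->
  al (iter t phi G) 0 d = al G 0 d
  - (\sum_(0 <= s < t)
       ((path_row G s d == 0%N) && (0 < path_row G s d.+1)))%N%:Z.
Proof.
move=> hd; elim: t => [|t IH]; first by rewrite big_geq //= subr0.
rewrite iterS phi_al ?iter_phi_side // IH big_nat_recr //= /path_row; lia.
Qed.

Lemma sum_hits_range (f : nat -> nat) (a b t : nat) :
  (\sum_(a <= v < b) \sum_(0 <= s < t) (f s == v) =
   \sum_(0 <= s < t) (a <= f s < b))%N.
Proof.
rewrite exchange_big_nat /=; apply: eq_bigr => s _.
have [h|h] := boolP (a <= f s < b)%N; last first.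
  by rewrite big_nat big1 // => v hv; case: eqP => // e; move: h; rewrite e hv.
rewrite (bigD1_seq (f s)) ?iota_uniq ?mem_index_iota //= eqxx.
by rewrite big1_seq // => v /andP[ne _]; rewrite eq_sym (negPf ne).
Qed.

(** A path displaces from row d a letter smaller than the one it inserts,
    hence smaller than all letters inserted there by earlier paths. *)
Lemma inserted_letters_stay (A : edge_array) (t v d : nat) :
  (0 < v < d)%N -> (d <= side A)%N ->
  (forall s, (s <= t)%N -> LR_hive (iter s phi A)) ->
  (\sum_(0 <= s < t) (path_row A s d.+1 == v))%N%:Z
    <= gradU (iter t phi A) v d.
Proof.
move=> hv hd; elim: t => [|t IH] hLR.
  rewrite big_geq //; have /LR_hiveP[_ Hrh _] := hLR 0%N (leqnn _).
  by have [] := Hrh v d hv hd.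
have /LR_hiveP[_ Hrh _] := hLR t.+1 (leqnn _).
have [_ U0 _] := Hrh v d hv ltac:(rewrite iter_phi_side; lia).
have {}IH := IH (fun s hs => hLR s (leqW hs)).
have [e|ne] := eqVneq (path_row A t d) v.
  rewrite big_nat big1 // => s hs; apply/eqP; rewrite eqb0.
  have := @path_row_antitone A s t d.+1 isT ltac:(lia).
  by case: (path_row_step t hd); lia.
rewrite iterS phi_gradU ?iter_phi_side // big_nat_recr //=.
by move: ne IH; rewrite /path_row; lia.
Qed.

(** For [A] take a hive whose bottom diagonal has no letter r+1 left, and for
    [B] the hive reached after its [N] paths and the deletion of the diagonal,
    likewise without its letters r. The shift [c] compensates for the removed
    letters: nu_r of them for [B] and nu_{r+1} for [A], so c = nu_r - nu_{r+1}.

    Suppose the claim holds in diagonal d+1. Let a be the letter that path t+c of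
    [A] inserted in row d, and b > a the one that path t of [B] inserts there.
    If [B] had no letter in the interval from a to b-1 at that time, all letters
    put into this interval by [A] would have been displaced by paths s < t of
    [B]. By induction on t such a path displaces a letter at least as large as
    the one that path s+c of [A] inserted, so that the latter lies in the same
    interval; thus fewer letters were displaced than inserted. *)
Lemma paths_interlace (A B : edge_array) (N c t d : nat) :
  side A = (side B).+1 ->
  (forall s, (s <= N)%N -> LR_hive (iter s phi A)) ->
  gradU A (side B) (side A) <= c%:Z ->
  (forall i d, (0 < i < d)%N -> (d <= side B)%N ->
     gradU B i d = gradU (iter N phi A) i d) ->
  (t + c < N)%N -> (0 < d <= side B)%N ->
  (path_row A (t + c) d.+1 <= path_row B t d)%N.
Proof.
set r := side B => hside hLR hc hB ht /andP[d0 hd].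
pose P e := (0 < e)%N -> forall t, (t + c < N)%N ->
    path_row A (t + c) e = 0%N \/ (path_row A (t + c) e < path_row B t e)%N.
have weak_step e : (0 < e <= r)%N -> P e.+1 ->
    forall t, (t + c < N)%N -> (path_row A (t + c) e.+1 <= path_row B t e)%N.
  move=> /andP[e0 he] /(_ isT) Pe; elim/ltn_ind=> {}t IH {}ht.
  case: (Pe t ht) => [-> //|].
  set a := path_row A (t + c) e.+1; set b := path_row B t e.+1 => ab.
  have be : (b <= e)%N by rewrite -ltnS; apply: path_row_bound; lia.
  rewrite leqNgt; apply/negP => lt_a.
  have few : (\sum_(0 <= s < N) (a <= path_row A s e.+1 < b) <=
              \sum_(0 <= s < t) (a <= path_row B s e < b))%N.
    rewrite -!sum_hits_range big_nat [leqRHS]big_nat; apply: leq_sum => v hv.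
    have := @phi_row_gap (iter t phi B) e v.
    rewrite iter_phi_side -/(path_row B t e) -/(path_row B t e.+1) -/b.
    move=> /(_ he ltac:(lia)).
    rewrite iter_phi_gradU ?hB //; try lia.
    by have := @inserted_letters_stay A N v e ltac:(lia) ltac:(lia) hLR; lia.
  have shift : (\sum_(0 <= s < t) (a <= path_row B s e < b) <=
                \sum_(0 <= s < t) (a <= path_row A (s + c) e.+1 < b))%N.
    rewrite big_nat [leqRHS]big_nat; apply: leq_sum => s hs.
    have := IH s ltac:(lia) ltac:(lia).
    by have := @path_row_antitone A (s + c) (t + c) e.+1 isT ltac:(lia); lia.
  have many : (\sum_(0 <= s < t.+1) (a <= path_row A (s + c) e.+1 < b) <=
               \sum_(0 <= s < N) (a <= path_row A s e.+1 < b))%N.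
    rewrite [leqRHS](big_cat_nat (n := c)) //=; last lia.
    rewrite [X in (_ <= _ + X)%N](big_cat_nat (n := (t.+1 + c)%N)) //=; try lia.
    by rewrite -[X in (_ <= _ + (\sum_(X <= _ < _) _ + _))%N]add0n big_addn addnK; lia.
  by move: many; rewrite big_nat_recr //= leqnn ab; lia.
have Pall : forall e, (e <= r.+1)%N -> P e; last first.
  by apply: (weak_step d ltac:(lia) _ t ht); apply: Pall; lia.
move=> {t ht}; apply: descending_ind => [_ t ht|e he IH e0 t ht]; last first.
  have := weak_step e ltac:(lia) IH t ht.
  by have := @path_row_step A (t + c) e ltac:(lia); lia.
right; rewrite (path_row_top (G := B)) //.
have := @path_row_bound A (t + c) r.+1 ltac:(lia).
(* A path of A starting at the letter r would have to find one in the bottom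
   row after t + c letters r were removed, but there were at most c at first. *)
rewrite ltnS leq_eqVlt => /predU1P[e|//].
have := @phi_row_cases (iter (t + c) phi A) r.+1.
rewrite iter_phi_side -/(path_row A (t + c) r.+1) e hside leqnn.
case=> // [|[_]]; first lia.
rewrite iter_phi_gradU ?hside //; last lia.
rewrite [X in _ + X%:Z]big1 => [|s _]; last by rewrite path_row_top hside //; lia.
rewrite big_nat (eq_bigr (fun=> 1%N)) => [|s hs].
  by rewrite -big_nat sum_nat_const_nat; move: hc; rewrite hside; lia.
have := @path_row_antitone A s (t + c) r.+1 isT ltac:(lia).
by have := @path_row_bound A s r.+1 ltac:(lia); rewrite e; lia.
Qed.

(** * Counting terminations *)

(** The paths terminating at a level at most i are those still alive in
    diagonal i+1. *)
Lemma terminations_up_to (G : edge_array) (N i : nat) : (i <= side G)%N ->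
  (\sum_(1 <= k < i.+1) \sum_(0 <= s < N)
      ((path_row G s k == 0) && (0 < path_row G s k.+1)) =
   \sum_(0 <= s < N) (0 < path_row G s i.+1))%N.
Proof.
elim: i => [|i IH] hi.
  rewrite big_geq // big1 // => s _.
  by have := @path_row_bound G s 1 ltac:(lia); lia.
rewrite big_nat_recr //= IH; last lia.
rewrite -big_split /=; apply: eq_bigr => s _.
by have := path_row_step s hi; lia.
Qed.

(** The estimate behind L >= 0 for the partner. Look at the hive just after
    the last path of level i: no path has terminated at level i+1 so far, since
    levels weakly increase, so the left boundary labels i and i+1 of that hive
    are those of the conclusion. *)
Lemma terminations_le_drop (G : edge_array) (N i : nat) : (0 < i < side G)%N ->
  (forall s, (s <= N)%N -> LR_hive (iter s phi G)) ->
  al G 0 i.+1 <= al G 0 i -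
    (\sum_(0 <= s < N)
       ((path_row G s i == 0) && (0 < path_row G s i.+1)))%N%:Z.
Proof.
move=> hi; elim: N => [|N IH] hLR.
  rewrite big_geq // subr0; have /LR_hiveP[_ Hrh _] := hLR 0%N isT.
  by apply: (al0_ge (H := G) Hrh); lia.
have [/andP[p0 p1]|ne] :=
  boolP ((path_row G N i == 0%N) && (0 < path_row G N i.+1)%N); last first.
  by rewrite big_nat_recr //= (negPf ne) addn0; apply: IH => s hs; apply: hLR; lia.
have /LR_hiveP[_ Hrh _] := hLR N.+1 (leqnn _).
have := @al0_ge _ i i.+1 Hrh ltac:(lia) ltac:(rewrite iter_phi_side; lia).
rewrite !iter_phi_al0; try lia.
rewrite [X in _ - X%:Z <= _]big_nat big1 => [|s hs]; first by rewrite subr0.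
by have := @path_row_antitone G s N i.+1 isT ltac:(lia); lia.
Qed.

(** The estimate behind R >= 0 for the partner. Apart from the first [c]
    paths of [A], each path of level at most i is matched by a path of [B] of
    level at most i-1. The match is one of the [N'] paths of [B] because after
    those no letter is left to start a path. *)
Lemma terminations_interlace (A B : edge_array) (N N' c i : nat) :
  side A = (side B).+1 ->
  (forall s, (s <= N)%N -> LR_hive (iter s phi A)) ->
  gradU A (side B) (side A) <= c%:Z ->
  (forall i d, (0 < i < d)%N -> (d <= side B)%N ->
     gradU B i d = gradU (iter N phi A) i d) ->
  (forall v, (0 < v < side B)%N -> gradU (iter N' phi B) v (side B) = 0) ->
  (0 < i <= side B)%N ->
  (\sum_(0 <= s < N) (0 < path_row A s i.+1) <=
   c + \sum_(0 <= s < N') (0 < path_row B s i))%N.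
Proof.
move=> hside hLR hc hB hend hi.
have later t : (t + c < N)%N -> (0 < path_row A (t + c) i.+1)%N ->
    (0 < path_row B t i)%N && (t < N')%N.
  move=> ht hp; apply/andP; split.
    exact: leq_trans hp (paths_interlace hside hLR hc hB ht hi).
  rewrite ltnNge; apply/negP => hN'.
  have hr : (0 < path_row A (t + c) (side B).+1)%N.
    by apply: phi_row_pos_up hp _; rewrite iter_phi_side hside; lia.
  have := paths_interlace hside hLR hc hB ht (d := side B) ltac:(lia).
  have := @path_row_antitone B N' t (side B) ltac:(lia) hN'.
  have := @phi_row_cases (iter N' phi B) (side B).
  rewrite iter_phi_side => /(_ (leqnn _)); rewrite -/(path_row B N' (side B)).
  case=> [|[hv]]; first lia.
  by have hb := @path_row_bound B N' (side B) ltac:(lia); rewrite hend; lia.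
have [hNc|hcN] := leqP N c.
  apply: leq_trans (leq_trans hNc (leq_addr _ _)).
  rewrite -[leqRHS](subn0 N) -[leqRHS]muln1 -sum_nat_const_nat.
  by apply: leq_sum => s _; apply: leq_b1.
rewrite (big_cat_nat (n := c)) //=; last lia.
apply: leq_add.
  rewrite -[leqRHS](subn0 c) -[leqRHS]muln1 -sum_nat_const_nat.
  by apply: leq_sum => s _; apply: leq_b1.
rewrite -{1}[c]add0n big_addn.
apply: (@leq_trans (\sum_(0 <= t < N - c)
                      ((0 < path_row B t i) && (t < N')))%N).
  rewrite big_nat [leqRHS]big_nat; apply: leq_sum => t ht.
  by have := later t ltac:(lia); case: (0 < path_row A _ _)%N => // ->.
have [h|h] := leqP (N - c) N'.
  rewrite [leqRHS](big_cat_nat (n := (N - c)%N)) //=.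
  by apply: leq_trans (leq_addr _ _); apply: leq_sum => t _; lia.
rewrite (big_cat_nat (n := N')) //=; last lia.
rewrite [X in (_ + X <= _)%N]big_nat [X in (_ + X <= _)%N]big1.
  by rewrite addn0; apply: leq_sum => t _; lia.
by move=> t ht; lia.
Qed.

(** * The three phases of a full path removal *)

Lemma iter_LR_hive (ok : edge_array -> Prop) (f : edge_array -> edge_array)
    (m : nat) (H : edge_array) :
  (forall G, LR_hive G -> ok G -> LR_hive (f G)) -> LR_hive H ->
  (forall t, (t < m)%N -> LR_hive (iter t f H) -> ok (iter t f H)) ->
  forall t, (t <= m)%N -> LR_hive (iter t f H).
Proof.
move=> fLR HLR fok; elim=> [//|t IH] ht.
by have {}IH := IH (ltnW ht); apply: fLR => //; apply: fok.
Qed.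

Lemma chi_LR (H : edge_array) : LR_hive H -> chi_ok H -> LR_hive (chi H).
Proof.
move=> /LR_hiveP[Htri Hrh Hc] hok; apply/LR_hiveP; split.
- move=> i j hi hj; have [E1 E2] := Htri i j hi hj.
  have {}hj : (j <= side H)%N := hj.
  by split=> [|lt]; [rewrite /= E1; case: ifP; lia
                    |rewrite /= (E2 lt); do 2?[case: ifP]; lia].
- move=> i j hi hj; have [hR hU hL] := Hrh i j hi hj.
  have {}hj : (j <= side H)%N := hj.
  split=> //.
  by move: hL; rewrite /gradL /=; do 2?[case: ifP]; lia.
- move=> h0; have [hmu hnu] := Hc h0; split=> //.
  by move: hok; rewrite /chi_ok /nu_last /= !eqxx /=; lia.
Qed.

Lemma iter_chi_side (H : edge_array) (t : nat) : side (iter t chi H) = side H.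
Proof. by elim: t => //= t. Qed.

Lemma iter_chi_al (H : edge_array) (t : nat) : al (iter t chi H) = al H.
Proof. by elim: t => //= t. Qed.

Lemma iter_chi_be (H : edge_array) (t i j : nat) :
  be (iter t chi H) i j =
  if (i == side H) && (j == side H) then be H i j - t%:Z else be H i j.
Proof.
elim: t => [|t IH]; first by rewrite subr0 if_same.
by rewrite iterS /= IH iter_chi_side; case: (_ && _) => //=; lia.
Qed.

Lemma iter_chi_ga (H : edge_array) (t i j : nat) :
  ga (iter t chi H) i j =
  if (i == side H) && (j == side H) then ga H i j - t%:Z else ga H i j.
Proof.
elim: t => [|t IH]; first by rewrite subr0 if_same.
by rewrite iterS /= IH iter_chi_side; case: (_ && _) => //=; lia.
Qed.

Lemma omega_LR (H : edge_array) : LR_hive H -> omega_ok H -> LR_hive (omega H).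
Proof.
move=> /LR_hiveP[Htri Hrh Hc] hok; apply/LR_hiveP; split.
- move=> i j hi hj; have [E1 E2] := Htri i j hi hj.
  have {}hj : (j <= side H)%N := hj.
  by split=> [|lt]; [rewrite /= E1; do 2?[case: ifP]; lia
                    |rewrite /= (E2 lt); do 2?[case: ifP]; lia].
- move=> i j hi hj; have [hR hU hL] := Hrh i j hi hj.
  have {}hj : (j <= side H)%N := hj.
  split=> //; [move: hR; rewrite /gradR|move: hU; rewrite /gradU];
    by rewrite /=; do 2?[case: ifP]; lia.
- move=> h0; have {}h0 : (0 < side H)%N := h0; have [hmu hnu] := Hc h0; split=> //.
  by move: hok; rewrite /omega_ok /mu_last /= eqxx h0 /=; lia.
Qed.

Lemma iter_omega_side (H : edge_array) (t : nat) :
  side (iter t omega H) = side H.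
Proof. by elim: t => //= t. Qed.

Lemma iter_omega_be (H : edge_array) (t : nat) : be (iter t omega H) = be H.
Proof. by elim: t => //= t. Qed.

Lemma iter_omega_al (H : edge_array) (t i j : nat) :
  al (iter t omega H) i j =
  if (i < side H)%N && (j == side H) then al H i j - t%:Z else al H i j.
Proof.
elim: t => [|t IH]; first by rewrite subr0 if_same.
by rewrite iterS /= IH iter_omega_side; case: (_ && _) => //=; lia.
Qed.

Lemma iter_omega_ga (H : edge_array) (t i j : nat) :
  ga (iter t omega H) i j =
  if (1 <= i <= side H)%N && (j == side H) then ga H i j - t%:Z else ga H i j.
Proof.
elim: t => [|t IH]; first by rewrite subr0 if_same.
by rewrite iterS /= IH iter_omega_side; case: (_ && _) => //=; lia.
Qed.

Lemma iter_phi_be_last (G : edge_array) (t i : nat) :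
  be (iter t phi G) i (side G) = be G i (side G).
Proof.
elim: t => // t IH; have := phi_be_last (iter t phi G) i.
by rewrite iter_phi_side IH -iterS.
Qed.

Lemma iter_phi_ga_diag (G : edge_array) (t k : nat) : (0 < k <= side G)%N ->
  ga (iter t phi G) k k = ga G k k - (if k == side G then t%:Z else 0).
Proof.
move=> hk; elim: t => [|t IH]; first by rewrite if_same subr0.
rewrite iterS phi_ga ?iter_phi_side // IH.
have := @phi_row_bound (iter t phi G) k.+1.
by rewrite iter_phi_side; case: ifP; lia.
Qed.

(** The labels of the last diagonal increase somewhere, so some U is
    positive there. *)
Lemma phi_okP (H : edge_array) :
  al H 0 (side H) < al H (side H).-1 (side H) -> phi_ok H.
Proof.
move=> h; suff gen i : (i < side H)%N -> al H 0 (side H) < al H i (side H) ->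
    phi_ok H.
  case e: (side H) h => [|r]; first by rewrite ltxx.
  by rewrite -[r.+1.-1]/r -e; apply: gen; lia.
elim: i => [|i IH] hi hal; first by rewrite ltxx in hal.
have [hU|hU] := ltrP 0 (gradU H i.+1 (side H)); first by exists i.+1; split; lia.
by apply: IH; [lia|move: hU; rewrite /gradU /=; lia].
Qed.

Lemma corner_labels (H : edge_array) : LR_hive H -> (0 < side H)%N ->
  [/\ 0 <= nu_last H, 0 <= mu_last H, 0 <= phi_count H
    & phi_count H = al H (side H).-1 (side H) - mu_last H].
Proof.
move=> /LR_hiveP[Htri Hrh Hc] r0; have [hmu hnu] := Hc r0.
have [E _] := Htri (side H) (side H) ltac:(lia) ltac:(lia).
have E' : phi_count H = al H (side H).-1 (side H) - mu_last H.
  by rewrite /phi_count /lam_last E /nu_last; lia.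
split=> //; have := @al_row_le H 0 (side H).-1 (side H) Hrh ltac:(lia) (leqnn _).
by rewrite E' /mu_last; lia.
Qed.

Lemma chi_phase (H : edge_array) (t : nat) : LR_hive H -> (0 < side H)%N ->
  (t <= `|nu_last H|)%N -> LR_hive (iter t chi H).
Proof.
move=> hH r0; have [hnu _ _ _] := corner_labels hH r0.
apply: (iter_LR_hive chi_LR hH) => {}t ht _.
by rewrite /chi_ok /nu_last iter_chi_side iter_chi_be !eqxx /= -/(nu_last H); lia.
Qed.

Lemma after_chi_side (H : edge_array) : side (after_chi H) = side H.
Proof. exact: iter_chi_side. Qed.

Lemma phi_phase_be_last (H : edge_array) (i t : nat) : 0 <= nu_last H ->
  be (iter t phi (after_chi H)) i (side H) =
  if i == side H then 0 else be H i (side H).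
Proof.
move=> h; have := iter_phi_be_last (after_chi H) t i.
rewrite after_chi_side => ->; rewrite /after_chi iter_chi_be eqxx andbT.
by case: eqP => [->|//]; rewrite /nu_last in h *; lia.
Qed.

Lemma phi_phase_ga_diag (H : edge_array) (k t : nat) : (0 < k <= side H)%N ->
  0 <= nu_last H ->
  ga (iter t phi (after_chi H)) k k =
  ga H k k - (if k == side H then nu_last H + t%:Z else 0).
Proof.
move=> hk h; rewrite iter_phi_ga_diag ?after_chi_side // /after_chi.
by rewrite iter_chi_ga andbb; case: eqP => [->|//]; lia.
Qed.

(** Each path lowers the corner label by 1, and the corner label exceeds
    mu_r as long as fewer than lambda_r - mu_r - nu_r paths are removed. *)
Lemma phi_phase_ok (H : edge_array) (t : nat) : LR_hive H -> (0 < side H)%N ->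
  (t < `|phi_count H|)%N -> LR_hive (iter t phi (after_chi H)) ->
  phi_ok (iter t phi (after_chi H)).
Proof.
move=> hH r0 ht /LR_hiveP[Htri _ _]; apply: phi_okP.
have [h1 h2 h3 h4] := corner_labels hH r0.
rewrite iter_phi_side after_chi_side.
have [+ _] := Htri (side H) (side H) ltac:(lia)
  ltac:(rewrite iter_phi_side after_chi_side; lia).
rewrite phi_phase_be_last // phi_phase_ga_diag ?r0 ?leqnn // eqxx.
rewrite iter_phi_al0 ?after_chi_side ?r0 ?leqnn // /after_chi iter_chi_al.
by move: h3 h4 ht; rewrite /phi_count /lam_last /mu_last; lia.
Qed.

Lemma phi_phase (H : edge_array) (t : nat) : LR_hive H -> (0 < side H)%N ->
  (t <= `|phi_count H|)%N -> LR_hive (iter t phi (after_chi H)).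
Proof.
move=> hH r0; apply: (iter_LR_hive phi_LR); first exact: chi_phase.
by move=> {}t; apply: phi_phase_ok.
Qed.

Lemma path_row_last_pos (H : edge_array) (s : nat) :
  LR_hive H -> (0 < side H)%N -> (s < `|phi_count H|)%N ->
  (0 < path_row (after_chi H) s (side H))%N.
Proof.
move=> hH r0 hs.
have := phi_ok_row (phi_phase_ok hH r0 hs (phi_phase hH r0 (ltnW hs))).
by rewrite iter_phi_side after_chi_side.
Qed.

Lemma after_phi_side (H : edge_array) : side (after_phi H) = side H.
Proof. by rewrite iter_phi_side after_chi_side. Qed.

Lemma after_phi_mu_last (H : edge_array) : LR_hive H -> (0 < side H)%N ->
  mu_last (after_phi H) = mu_last H.
Proof.
move=> hH r0; rewrite /mu_last after_phi_side iter_phi_al0 ?after_chi_side ?r0 ?leqnn //.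
rewrite big_nat big1 ?subr0 => [|s hs]; first by rewrite /after_chi iter_chi_al.
by have := path_row_last_pos hH r0 hs; case: eqP => // ->.
Qed.

Lemma after_phi_last (H : edge_array) : LR_hive H -> (0 < side H)%N ->
  [/\ be (after_phi H) (side H) (side H) = 0,
      ga (after_phi H) (side H) (side H) = mu_last H
    & forall i, (0 < i < side H)%N -> gradU (after_phi H) i (side H) = 0].
Proof.
move=> hH r0; have [h1 h2 h3 h4] := corner_labels hH r0.
have Ebe : be (after_phi H) (side H) (side H) = 0.
  by rewrite /after_phi phi_phase_be_last // eqxx.
have Ega : ga (after_phi H) (side H) (side H) = mu_last H.
  rewrite /after_phi phi_phase_ga_diag ?r0 ?leqnn // eqxx.
  by move: h3; rewrite /phi_count /lam_last; lia.
split=> // i hi.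
have /LR_hiveP[Htri Hrh _] := phi_phase hH r0 (leqnn _).
rewrite -/(after_phi H) in Htri Hrh; have es := after_phi_side H.
have [E _] := Htri (side H) (side H) ltac:(lia) ltac:(lia).
have := @al_row_le _ i (side H).-1 (side H) Hrh ltac:(lia) ltac:(lia).
have := @al_row_le _ 0 i.-1 (side H) Hrh ltac:(lia) ltac:(lia).
have := @al_row_le _ i.-1 i (side H) Hrh ltac:(lia) ltac:(lia).
have := after_phi_mu_last hH r0; rewrite /mu_last after_phi_side /gradU -/(mu_last H).
by move: E; rewrite Ebe Ega; lia.
Qed.

Lemma omega_phase (H : edge_array) (t : nat) : LR_hive H -> (0 < side H)%N ->
  (t <= `|mu_last H|)%N -> LR_hive (iter t omega (after_phi H)).
Proof.
move=> hH r0; have [_ hmu _ _] := corner_labels hH r0.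
apply: (iter_LR_hive omega_LR); first exact: phi_phase.
move=> {}t ht _; rewrite /omega_ok /mu_last iter_omega_side iter_omega_al eqxx.
rewrite after_phi_side r0 /=; have := after_phi_mu_last hH r0.
by rewrite {1}/mu_last after_phi_side; lia.
Qed.

(** * Full path removals *)

Lemma ga_diag_ge (H : edge_array) (i j : nat) :
  triangles H -> rhombi H -> (0 < i <= j)%N -> (j <= side H)%N ->
  ga H j j <= ga H i i.
Proof.
move=> Htri Hrh; elim: j => [|j IH] hi hj; first lia.
have [->//|ne] := eqVneq i j.+1.
apply: le_trans (IH ltac:(lia) ltac:(lia)).
have [-> _] := Htri j.+1 j.+1 ltac:(lia) hj.
have [-> _] := Htri j j ltac:(lia) ltac:(lia).
apply: lerD; last by apply: (be_diag_ge Hrh); lia.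
by have [] := Hrh j j.+1 ltac:(lia) hj; rewrite /gradR /=; lia.
Qed.

(** The lower boundary is weakly decreasing, so a missing part means that
    lambda_r = 0; and lambda_r bounds mu_r + nu_r. *)
Lemma short_lower_boundary (H : edge_array) :
  LR_hive H -> lower_length H != side H ->
  [/\ nu_last H = 0, mu_last H = 0 & phi_count H = 0].
Proof.
move=> hH; rewrite /lower_length -{2}(size_iota 1 (side H)) -all_count.
case/allPn=> k; rewrite mem_iota -leNgt => hk gak.
have r0 : (0 < side H)%N by lia.
have [h1 h2 h3 h4] := corner_labels hH r0.
have /LR_hiveP[Htri Hrh _] := hH.
have := @ga_diag_ge H k (side H) Htri Hrh ltac:(lia) (leqnn _).
by split; move: h3; rewrite /phi_count /lam_last; lia.
Qed.

(** If the lower boundary is short, the three exponents are 0, so both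
    branches of the definition agree. *)
Lemma thetaE (H : edge_array) : LR_hive H -> theta H = after_omega H.
Proof.
move=> hH; rewrite /theta; case: ifP => // /negbT short.
have [Enu Emu Ephi] := short_lower_boundary hH short.
by rewrite /after_omega /after_phi /after_chi Enu Emu Ephi.
Qed.

Lemma phi_terminationsE (H : edge_array) (k : nat) :
  LR_hive H -> (0 < k < side H)%N ->
  phi_terminations H k =
  (\sum_(0 <= s < `|phi_count H|)
     ((path_row (after_chi H) s k == 0) && (0 < path_row (after_chi H) s k.+1)))%N.
Proof.
move=> hH hk; rewrite /phi_terminations; case: ifP => [_|/negbT short]; last first.
  by have [_ _ ->] := short_lower_boundary hH short; rewrite big_geq.
rewrite -sum1_count big_mkcond /= /index_iota subn0; apply: eq_bigr => s _.
by rewrite phi_level_eq ?iter_phi_side ?after_chi_side // /path_row; case: (_ && _).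
Qed.

Lemma sum_phi_terminations (H : edge_array) (i : nat) :
  LR_hive H -> (i < side H)%N ->
  (\sum_(1 <= k < i.+1) phi_terminations H k =
   \sum_(0 <= s < `|phi_count H|) (0 < path_row (after_chi H) s i.+1))%N.
Proof.
move=> hH hi; rewrite -terminations_up_to ?after_chi_side; last lia.
rewrite big_nat [RHS]big_nat; apply: eq_bigr => k hk.
by apply: phi_terminationsE => //; lia.
Qed.

Lemma theta_definedP (H : edge_array) :
  LR_hive H -> (0 < side H)%N -> theta_defined H.
Proof.
move=> hH r0 _; have [h1 h2 h3 h4] := corner_labels hH r0.
split; split=> // t ht; split.
- by apply: chi_phase => //; lia.
- by rewrite /chi_ok /nu_last iter_chi_side iter_chi_be !eqxx /= -/(nu_last H); lia.
- by apply: phi_phase => //; lia.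
- by apply: phi_phase_ok => //; apply: phi_phase => //; lia.
- by apply: omega_phase => //; lia.
- rewrite /omega_ok /mu_last iter_omega_side iter_omega_al eqxx after_phi_side r0 /=.
  by have := after_phi_mu_last hH r0; rewrite {1}/mu_last after_phi_side; lia.
Qed.

Lemma theta_LR (H : edge_array) :
  LR_hive H -> (0 < side H)%N -> LR_hive (theta H).
Proof. by move=> hH r0; rewrite thetaE //; apply: omega_phase. Qed.

Lemma theta_side (H : edge_array) : side (theta H) = side H.
Proof.
rewrite /theta; case: ifP => // _.
by rewrite /after_omega iter_omega_side after_phi_side.
Qed.

Lemma theta_gradU (H : edge_array) (i d : nat) : LR_hive H ->
  (0 < i < d)%N -> (d <= side H)%N ->
  gradU (theta H) i d = gradU (after_phi H) i d.
Proof.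
move=> hH hi hd; rewrite thetaE // /after_omega /gradU !iter_omega_al after_phi_side.
by do 2?[case: ifP]; lia.
Qed.

Lemma theta_empty_diagonal (H : edge_array) :
  LR_hive H -> (0 < side H)%N -> empty_diagonal (theta H).
Proof.
move=> hH r0; have [h1 h2 _ _] := corner_labels hH r0.
have [Ebe Ega EU] := after_phi_last hH r0.
have Emu := after_phi_mu_last hH r0; rewrite /mu_last after_phi_side -/(mu_last H) in Emu.
rewrite /empty_diagonal theta_side; split.
- by rewrite thetaE // /after_omega iter_omega_ga after_phi_side r0 leqnn eqxx /= Ega; lia.
- by rewrite thetaE // /after_omega iter_omega_al after_phi_side r0 eqxx /= Emu; lia.
- by rewrite thetaE // /after_omega iter_omega_be.
- by move=> i hi; rewrite theta_gradU // EU.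
Qed.

Lemma kappa_LR (H : edge_array) : LR_hive H -> LR_hive (kappa H).
Proof.
move=> [/int_hiveP[Htri Hrh] Hal Hbg]; split.
- by apply/int_hiveP; split=> i j hi /= hj;
    [have := Htri i j hi ltac:(lia)|have := Hrh i j hi ltac:(lia)].
- by move=> i j /= hij; apply: Hal; lia.
- by move=> i j hi /= hj; apply: Hbg => //; lia.
Qed.

Lemma kappa_theta_ga (H : edge_array) (k : nat) :
  LR_hive H -> (0 < k < side H)%N -> ga (kappa (theta H)) k k = ga H k k.
Proof.
move=> hH hk; have [h1 _ _ _] := corner_labels hH ltac:(lia).
rewrite /= thetaE // /after_omega iter_omega_ga after_phi_side.
rewrite /after_phi phi_phase_ga_diag //; last lia.
by do 2?[case: ifP]; lia.
Qed.

Lemma kappa_theta_al0 (H : edge_array) (k : nat) :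
  LR_hive H -> (0 < k < side H)%N ->
  al (kappa (theta H)) 0 k = al H 0 k - (phi_terminations H k)%:Z.
Proof.
move=> hH hk; rewrite /= thetaE // phi_terminationsE //.
rewrite /after_omega iter_omega_al after_phi_side.
have /negPf -> : k != side H by lia.
by rewrite andbF /after_phi iter_phi_al0 ?after_chi_side ?iter_chi_al //; lia.
Qed.

(** The labels beta on the diagonals r-1 and r differ by U on the r-th
    diagonal, which is 0 after the removal, and no path changes the last
    diagonal of beta above the corner. This is why nu survives. *)
Lemma kappa_theta_be (H : edge_array) (k : nat) :
  LR_hive H -> (0 < k < side H)%N ->
  be (kappa (theta H)) k (side H).-1 = be H k (side H).
Proof.
move=> hH hk; have r0 : (0 < side H)%N by lia.
have [h1 _ _ _] := corner_labels hH r0.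
have Elast : be (theta H) k (side H) = be H k (side H).
  rewrite thetaE // /after_omega iter_omega_be /after_phi phi_phase_be_last //.
  by case: eqP; lia.
have /LR_hiveP[Htri _ _] := theta_LR hH r0.
have [E1 E2] := Htri k (side H) ltac:(lia) ltac:(rewrite theta_side; lia).
have [_ _ _] := theta_empty_diagonal hH r0.
rewrite theta_side => /(_ k hk); rewrite /gradU /=.
by have := E2 ltac:(lia); rewrite E1 Elast; lia.
Qed.

(** * The reduction and the partner *)

Lemma reduced_full (H : edge_array) : reduced H (side H) = H.
Proof. by rewrite /reduced subnn. Qed.

Lemma reducedS (H : edge_array) (r : nat) : (r < side H)%N ->
  reduced H r = kappa (theta (reduced H r.+1)).
Proof. by move=> h; rewrite /reduced -(subnSK h). Qed.

Lemma reduced_spec (H : edge_array) (r : nat) :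
  LR_hive H -> (0 < side H)%N -> (r <= side H)%N ->
  [/\ side (reduced H r) = r, LR_hive (reduced H r)
    & forall k, (0 < k <= r)%N ->
      [/\ ga (reduced H r) k k = ga H k k,
          al (reduced H r) 0 k =
            al H 0 k - (\sum_(r.+1 <= m < (side H).+1) partnerV H k m)%N%:Z
        & be (reduced H r) k r = be H k (side H)]].
Proof.
move=> hH; case n: (side H) => [//|n'] _; move: r.
apply: descending_ind; rewrite -n.
  rewrite reduced_full; split=> // k hk; split=> //.
  by rewrite big_geq ?subr0.
move=> r hr [Es IH Ek]; rewrite reducedS; last lia.
have r0 : (0 < side (reduced H r.+1))%N by rewrite Es.
split.
- by rewrite /= theta_side Es.
- by apply: kappa_LR; apply: theta_LR.
move=> k hk; have [Ega Eal Ebe] := Ek k ltac:(lia); split.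
- by rewrite kappa_theta_ga ?Ega // Es; lia.
- rewrite kappa_theta_al0 // ?Eal; last by rewrite Es; lia.
  by rewrite [in RHS]big_ltn /partnerV; lia.
- rewrite -[in RHS]Ebe.
  by have := @kappa_theta_be (reduced H r.+1) k IH; rewrite Es => ->; lia.
Qed.

(** The labels beta of the partner are the left boundaries of the reduced
    hives, so its L gradients compare consecutive left boundaries; its R gradients
    compare numbers of terminations in consecutive removals. *)
Lemma partner_LR (H : edge_array) :
  LR_hive H -> (0 < side H)%N -> LR_hive (partner H).
Proof.
move=> hH n0; have n0' := n0; set n := side H in n0.
have spec r := @reduced_spec H r hH n0'.
have [h1 h2 _ _] := corner_labels hH n0'.
have Eal i j : al (partner H) i.+1 j = al (partner H) i j + (partnerV H i.+1 j)%:Z.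
  by rewrite /= big_nat_recr //=; lia.
have Ebe i j : (j < n)%N ->
    be (partner H) i j = be (partner H) i j.+1 - (partnerV H i j.+1)%:Z.
  by move=> hj; rewrite /= (big_ltn (m := j.+1)) ?ltnS //; lia.
have Ebe0 i j : (0 < i <= j)%N -> (j <= n)%N ->
    be (partner H) i j = al (reduced H j) 0 i.
  by move=> hi hj; have [_ _ Ek] := spec j hj; have [_ -> _] := Ek i hi.
apply/LR_hiveP; split.
- move=> [|i] [|j] // hi hj; split=> // lt.
  have -> : ga (partner H) i.+1 j.+1 =
    al (partner H) i j.+1 + be (partner H) i.+1 j.+1 by [].
  by rewrite Eal [j.+1.-1]/= (Ebe i.+1 j hj); lia.
- move=> [|i] [|j] // hi hj; have {}hj : (j < n)%N := hj.
  have [Es LRj Ej] := spec j.+1 hj; have [Es' LRj' Ej'] := spec j (ltnW hj).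
  have r0 : (0 < side (reduced H j.+1))%N by rewrite Es.
  have r0' : (0 < side (reduced H j))%N by rewrite Es'; lia.
  split.
  + have sideA : side (after_chi (reduced H j.+1)) =
        (side (after_chi (reduced H j))).+1.
      by rewrite !after_chi_side Es Es'.
    have [Enu Eal0 Ebj] := Ej j ltac:(lia).
    have [_ _ Ebj1] := Ej j.+1 ltac:(lia).
    have /LR_hiveP[Htri Hrh _] := LRj.
    have [_ U0 L0] := Hrh j j.+1 ltac:(lia) ltac:(lia).
    have [t1 t2] := Htri j j.+1 ltac:(lia) ltac:(lia).
    have {}t2 := t2 (ltnSn _).
    have hc : gradU (reduced H j.+1) j j.+1 <= be H j n - be H j.+1 n.
      by move: L0 t1 t2; rewrite -Ebj -Ebj1 /gradL /gradU /=; lia.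
    have := @terminations_interlace _ _ `|phi_count (reduced H j.+1)|
      `|phi_count (reduced H j)| `|be H j n - be H j.+1 n| i.+1 sideA.
    rewrite !after_chi_side Es Es'.
    have hV : (\sum_(1 <= k < i.+2) partnerV H k j.+1 = _)%N :=
      sum_phi_terminations (i := i.+1) LRj ltac:(lia).
    have hV' : (\sum_(1 <= k < i.+1) partnerV H k j = _)%N :=
      sum_phi_terminations (i := i) LRj' ltac:(lia).
    rewrite /gradR /= -/n hV hV' => main.
    suff : (\sum_(0 <= s < `|phi_count (reduced H j.+1)|)
        (0 < path_row (after_chi (reduced H j.+1)) s i.+2) <=
      `|be H j n - be H j.+1 n| + \sum_(0 <= s < `|phi_count (reduced H j)|)
        (0 < path_row (after_chi (reduced H j)) s i.+1))%N by lia.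
    apply: main; last lia.
    * by move=> s hs; apply: phi_phase.
    * by move: hc; rewrite /gradU /after_chi iter_chi_al; lia.
    * move=> i' d hi' hd; rewrite -/(after_phi _) -theta_gradU ?Es //; last lia.
      by rewrite /gradU /after_chi iter_chi_al reducedS.
    * move=> v hv; have [_ _] := after_phi_last LRj' r0'.
      by rewrite Es' => ->.
  + by rewrite /gradU Eal /=; lia.
  + rewrite /gradL [j.+1.-1]/= Ebe // (Ebe0 i.+2); [|lia..].
    rewrite (Ebe0 i.+1); [|lia..].
    rewrite /partnerV phi_terminationsE ?Es //.
    have := @terminations_le_drop (after_chi (reduced H j.+1))
      `|phi_count (reduced H j.+1)| i.+1.
    rewrite after_chi_side Es /after_chi iter_chi_al -/(after_chi _) => main.
    by rewrite subr_ge0; apply: main => // s hs; apply: phi_phase.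
- move=> _; rewrite /mu_last /nu_last /= -/n !big_geq // subr0 addr0.
  by split; [exact: h1|exact: h2].
Qed.

Theorem theorem8p4 (n : nat) (la mu nu : seq nat) (hn : (0 < n)%N)
    (hla : is_partition la) (hmu : is_partition mu) (hnu : is_partition nu)
    (hlen : (plength la <= n)%N)
    (hmula : part_sub mu la) (hnula : part_sub nu la)
    (hsize : sumn la = (sumn mu + sumn nu)%N)
    (H : edge_array) (hH : LR_hives n la mu nu H) :
  [/\ forall r : nat, (r <= n)%N ->
        side (reduced H r) = r /\ LR_hive (reduced H r),
      forall r : nat, (1 <= r <= n)%N ->
        [/\ theta_defined (reduced H r),
            LR_hive (theta (reduced H r))
          & empty_diagonal (theta (reduced H r))],
      empty_hive (reduced H 0)
    & LR_hives n la nu mu (partner H)].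
Proof.
case: hH => Es hH Hbd; have n0 : (0 < side H)%N by rewrite Es.
have spec r : (r <= n)%N -> _ :=
  fun hr => @reduced_spec H r hH n0 ltac:(rewrite Es; exact: hr).
split.
- by move=> r /spec[].
- move=> r /andP[r0 hr]; have [Er LRr _] := spec r hr.
  have r0' : (0 < side (reduced H r))%N by rewrite Er.
  split; [exact: theta_definedP|exact: theta_LR|exact: theta_empty_diagonal].
- by have [E [? _ _] _] := spec 0%N isT.
split; [by []|exact: partner_LR|].
move=> k hk; have [Ela Emu Enu] := Hbd k hk; split.
- have [Ek LRk Ebd] := spec k ltac:(lia).
  have [Ega Eal Ebe] := Ebd k ltac:(lia).
  have r0 : (0 < side (reduced H k))%N by rewrite Ek; lia.
  have [_ _ h3 _] := corner_labels LRk r0.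
  have hV : (\sum_(1 <= i < k.-1.+1) partnerV H i k = _)%N :=
    sum_phi_terminations (i := k.-1) LRk ltac:(lia).
  rewrite /= hV -Ebe -[_ - _]Eal prednK; last lia.
  rewrite big_nat (eq_bigr (fun=> 1%N)) => [|s hs]; last first.
    by have := path_row_last_pos LRk r0 hs; rewrite Ek => ->.
  rewrite -big_nat sum_nat_const_nat subn0 muln1.
  move: h3; rewrite /phi_count /lam_last /mu_last /nu_last Ek Ega Ela; lia.
- by rewrite /= big_geq // addr0 Es.
- by rewrite /= Es big_geq // subr0.
Qed.
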